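(* Let $X=(X,d,\mu)$ be a Borel metric measure space in which every closed ball of positive radius has positive and finite measure, let $r>0$, and let $E(X)$ be a Banach function space on $X$ with associated constants $\alpha(A)$ (for $A\subset X$ measurable with $\mu(A)<\infty$). Suppose that the averaging operator satisfies $A_r(E(X))\subset E(X)$ and that the following conditions hold: (1) $X$ satisfies the Vitali covering property; (2) $\inf\{\mu(B(x,r)) \mid x\in X\}>0$; (3) for each $x\in X$, $\mu(B(y,r))\to\mu(B(x,r))$ and $\alpha(B(x,r)\,\triangle\, B(y,r))\to 0$ as $y\to x$; (4) the norm $\|\cdot\|_E$ is absolutely continuous with respect to $1$. If $\mu(X)<\infty$, then $A_r:E(X)\to E(X)$ is compact.
   Context: Setting: $X=(X,d,\mu)$ is a metric space with metric $d$ and a measure $\mu$ for which all Borel sets are measurable; $B(x,s)$ denotes the closed ball centered at $x$ of radius $s$; it is assumed that $0<\mu(B(x,s))<\infty$ for all $x\in X$, $s>0$. $L^0(X)$ is the space of (real-valued) measurable functions on $X$, with functions equal a.e. identified; $\chi_A$ is the characteristic function of $A$; $A\triangle B=(A\setminus B)\cup(B\setminus A)$. Banach function space: a normed linear space $E(X)=(E(X),\|\cdot\|_E)\subset L^0(X)$ such that (B1) for each $f\in E(X)$, $\|f\|_E=\||f|\|_E$, and $\|f\|_E=0$ iff $f=0$ a.e.; (B2) for $f,g\in E(X)$, if $0\le g\le f$ a.e. then $\|g\|_E\le\|f\|_E$; (B3) for $f,f_n\in E(X)$ ($n\in\mathbb{N}$), if $0\le f_n\uparrow f$ a.e. then $\|f_n\|_E\uparrow\|f\|_E$;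 (B4) for every measurable $A\subset X$ with $\mu(A)<\infty$, $\chi_A\in E(X)$ and $\|\chi_A\|_E<\infty$; (B5) for each measurable $A\subset X$ with $\mu(A)<\infty$ there is $\alpha(A)\in(0,\infty)$ such that $\int_A|f|\,d\mu\le\alpha(A)\|f\|_E$ for all $f\in E(X)$. A choice of such constants $\alpha(A)$ is fixed. Such an $E(X)$ is a Banach space (complete). Averaging operator: $A_r:E(X)\to L^0(X)$, $A_rf(x)=\frac{1}{\mu(B(x,r))}\int_{B(x,r)}f(y)\,d\mu(y)$. Vitali covering property: whenever $A\subset X$ is any subset and $\mathcal{B}$ is any family of closed balls centered in $A$ with uniformly bounded radii such that for every $x\in A$ there is a ball in $\mathcal{B}$ centered at $x$ and $\inf\{s>0\mid B(x,s)\in\mathcal{B}\}=0$, there is a (at most) countable subfamily $\mathcal{B}'\subset\mathcal{B}$ of pairwise disjoint closed balls with $\mu(A\setminus\bigcup\mathcal{B}')=0$ (for non-measurable sets, $\mu$ is read as outer measure). Absolute continuity with respect to $1$ (defined when $\mu(X)<\infty$): $\|\chi_{A_i}\|_E\to 0$ as $i\to\infty$ whenever $\{A_i\}_{i\in\mathbb{N}}$ is a sequence of measurable sets in $X$ with $\chi_{A_i}\to 0$ a.e. Compact means: maps bounded sets to relatively compact sets. *)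

(* Defs.v *)
From HB Require Import structures.
From mathcomp Require Import all_boot all_order all_algebra.
From mathcomp Require Import all_classical all_reals all_analysis.

Set Implicit Arguments.
Unset Strict Implicit.
Unset Printing Implicit Defensive.

Import Order.TTheory GRing.Theory Num.Theory.
Import numFieldNormedType.Exports.

Local Open Scope classical_set_scope.
Local Open Scope ring_scope.

(* The sigma-algebra contains the Borel sets but may be larger. *)
HB.mixin Record hasBorelMeasurable (d : measure_display) (R : realType) X
    & Measurable d X & Metric R X := {
  borel_measurable : forall U : set X, open U -> measurable U
}.

#[short(type="borelMetricType")]
HB.structure Definition BorelMetric (d : measure_display) (R : realType) :=
  { X of Measurable d X & Metric R X & hasBorelMeasurable d R X }.

Section definitions.
Context (d : measure_display) (R : realType) (X : borelMetricType d R).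

(* Not the library's closed_ball, which is the closure of the open ball and can
   be strictly smaller in a general metric space. *)
Definition cball (x : X) (s : R) : set X := [set y | mdist x y <= s].

Variable mu : {measure set X -> \bar R}.

(* A family of balls is a set of subsets of X, so one of its members may have
   several centers and radii. The last condition uses the outer measure of mu,
   because A need not be measurable. *)
Definition vitali_covering_property : Prop :=
  forall (A : set X) (F : set (set X)),
    (exists M : R, forall b, F b ->
       exists x s, [/\ A x, 0 < s, s <= M & b = cball x s]) ->
    (forall x, A x ->
       [set s : R | 0 < s /\ F (cball x s)] !=set0 /\
       inf [set s : R | 0 < s /\ F (cball x s)] = 0) ->
    exists F' : set (set X),
      [/\ F' `<=` F, countable F', trivIset F' id &
          mu_ext mu (A `\` \bigcup_(b in F') b) = 0%E].

Definition average (r : R) (f : X -> R) (x : X) : R :=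
  (fine (mu (cball x r)))^-1 * \int[mu]_(y in cball x r) f y.

(* E(X) is a complete normed space E together with its inclusion incl in L^0(X),
   the quotient of the measurable functions by a.e. equality. An element of this
   quotient coerces to one of its representatives. *)
Record is_banach_function_space (E : completeNormedModType R)
    (incl : E -> {mfun_ mu, X >-> R}) (alpha : set X -> R) : Prop := {
  bfs_inj : injective incl ;
  bfs_linear : forall (a : R) (f g : E),
    incl (a *: f + g) = (fun x => a * incl f x + incl g x) %[ae mu] ;
  bfs_abs : forall f : E, exists2 g : E,
    incl g = (fun x => `|incl f x|) %[ae mu] & `|f| = `|g| ;
  bfs_norm_eq0 : forall f : E, `|f| = 0 <-> incl f = cst 0 %[ae mu] ;
  bfs_mono : forall f g : E,
    (\forall x \ae mu, 0 <= incl g x <= incl f x) ->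
    `|g| <= `|f| ;
  bfs_fatou : forall (f : E) (f_ : nat -> E),
    (\forall x \ae mu,
       [/\ forall n, 0 <= incl (f_ n) x,
           nondecreasing_seq (fun n => incl (f_ n) x) &
           incl (f_ n) x @[n --> \oo] --> incl f x]) ->
    nondecreasing_seq (fun n => `|f_ n|) /\ `|f_ n| @[n --> \oo] --> `|f| ;
  bfs_indic : forall A : set X, measurable A -> (mu A < +oo)%E ->
    exists f : E, incl f = \1_A %[ae mu] ;
  bfs_alpha_gt0 : forall A : set X, measurable A -> (mu A < +oo)%E ->
    0 < alpha A ;
  bfs_alpha : forall A : set X, measurable A -> (mu A < +oo)%E ->
    forall f : E,
      (\int[mu]_(x in A) (`|incl f x|)%:E <= (alpha A * `|f|)%:E)%E
}.

Section operators.
Context (E : completeNormedModType R) (incl : E -> {mfun_ mu, X >-> R}).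

Definition average_stable (r : R) : Prop :=
  forall f : E, exists g : E, incl g = average r (incl f) %[ae mu].

Definition average_op (r : R) (Er : average_stable r) (f : E) : E :=
  sval (cid (Er f)).

(* The elements chi i are the indicators of the A i, seen in E. *)
Definition absolutely_continuous_wrt1 : Prop :=
  forall A : nat -> set X, (forall i, measurable (A i)) ->
    (\forall x \ae mu, (\1_(A i) x : R) @[i --> \oo] --> (0 : R)) ->
    forall chi : nat -> E, (forall i, incl (chi i) = \1_(A i) %[ae mu]) ->
    `|chi i| @[i --> \oo] --> (0 : R).

End operators.

End definitions.

Definition compact_operator (R : realType) (E F : normedModType R)
    (T : E -> F) : Prop :=
  forall B : set E, bounded_set B -> precompact (T @` B).

(* Main.v *)
(** Since [mu] is finite, (B5) on the whole space makes the averages [A_r f],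
    [|f| <= M], uniformly bounded, and condition (3) makes them equicontinuous at
    each point.  The Vitali covering property then yields disjoint balls, finitely
    many of which, say [b_0, ..., b_(n-1)], contain all of [X] up to a set of small
    indicator norm, such that every [A_r f] oscillates by at most [eps] around its
    value at the center of each ball.  Sorting the [f] by the rounded values of
    [A_r f] at the [n] centers gives finitely many classes, and for [f], [g] in
    the same class [|A_r f - A_r g|] is at most [3 eps] on the balls and [2 C]
    elsewhere; hence the image of a bounded set is totally bounded. *)

Require Import Defs.
From HB Require Import structures.
From mathcomp Require Import all_boot all_order all_algebra.
From mathcomp Require Import all_classical all_reals all_analysis.
From mathcomp Require Import measurable_realfun.
From mathcomp Require Import ring lra.

Set Implicit Arguments.
Unset Strict Implicit.
Unset Printing Implicit Defensive.

Import Order.TTheory GRing.Theory Num.Theory.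
Import numFieldNormedType.Exports.

Local Open Scope classical_set_scope.
Local Open Scope ring_scope.

(* Total boundedness, stated so that no centers of balls have to be exhibited. *)
Lemma precompact_finite_coloring (R : realType) (E : completeNormedModType R)
    (T : Type) (f : T -> E) (B : set T) :
  (forall e : R, 0 < e -> exists (I : finType) (k : T -> I),
    forall s t, B s -> B t -> k s = k t -> `|f s - f t| < e) ->
  precompact (f @` B).
Proof.
move=> finB; rewrite precompactE compact_ultra /= => F UF FB.
have : cauchy F.
  apply: cauchy_exP => e e0.
  have e20 : 0 < e / 2 by rewrite divr_gt0.
  have [I [k kP]] := finB _ e20.
  (* The center of a color is the value of [f] at any point of [B] with that color, and 0 for a
     color that [B] does not use. *)
  have [c cP] : exists c : I -> E, forall t, B t -> `|c (k t) - f t| < e / 2.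
    have ex i : exists z, forall t, B t -> k t = i -> `|z - f t| < e / 2.
      have [[s [Bs ks]]|nex] := pselect (exists s, B s /\ k s = i).
        by exists (f s) => t Bt kt; apply: kP => //; rewrite ks kt.
      by exists 0 => t Bt kt; exfalso; apply: nex; exists t.
    have [c cP] := choice ex.
    by exists c => t Bt; exact: cP.
  (* If no ball [ball (c i) e] is in [F], the ultrafilter contains their complements, hence the
     finite intersection of these, which then meets the closure of the image; this contradicts
     [cP]. *)
  apply: contrapT => /forallNP nF.
  have nFc i : F (~` ball (c i) e).
    by case: (in_ultra_setVsetC (ball (c i) e) UF) => // /(nF _).
  have [z [clz nz]] := filter_ex (filterI FB (filter_forall _ nFc)).
  have [_ [[t Bt <-] zt]] := clz _ (nbhsx_ballx z _ e20).
  apply: (nz (k t)); apply: (@ball_split _ _ (f t)).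
    by rewrite -ball_normE /=; exact: cP.
  exact: ball_sym.
move=> /cauchy_cvg/cvg_ex[p Fp]; exists p; split => //.
apply: (@closed_cvg _ _ F _ id) => //; exact: closed_closure.
Qed.

(** * Domination, linear combinations and integrability in a Banach function space *)

Section banach_function_space.
Context (d : measure_display) (R : realType) (X : borelMetricType d R).
Variable mu : {measure set X -> \bar R}.
Variables (E : completeNormedModType R) (incl : E -> {mfun_ mu, X >-> R}).
Variable alpha : set X -> R.
Hypothesis bfsE : is_banach_function_space incl alpha.

Lemma bfs_dominated (f g : E) :
  (\forall x \ae mu, `|incl g x| <= `|incl f x|) -> `|g| <= `|f|.
Proof.
move=> gf; have [f' f'E ->] := bfs_abs bfsE f.
have [g' g'E ->] := bfs_abs bfsE g.
apply: (bfs_mono bfsE).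
apply: filterS3 f'E g'E gf => x /= /(_ I) -> /(_ I) -> ->.
by rewrite normr_ge0.
Qed.

Lemma bfs_sub (f g : E) :
  incl (f - g) = (fun x => incl f x - incl g x) %[ae mu].
Proof.
have := bfs_linear bfsE (-1) g f; rewrite scaleN1r addrC.
by apply: filterS => x /= xE Tx; rewrite xE// mulN1r addrC.
Qed.

Lemma bfs_lincomb2 (a b : R) (f g : E) :
  incl (a *: f + b *: g) = (fun x => a * incl f x + b * incl g x) %[ae mu].
Proof.
(* The linearity axiom scales only its first summand; adding 0, which vanishes a.e. by (B1), brings
   [b *: g] into that form. *)
have := bfs_linear bfsE b g 0; rewrite addr0.
have /(bfs_norm_eq0 bfsE) := @normr0 _ E.
apply: filterS3 (bfs_linear bfsE a f (b *: g)) => x /= + + + Tx.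
by move=> -> // -> // ->//; rewrite addr0.
Qed.

Hypothesis mu_fin : (mu setT < +oo)%E.

Lemma bfs_integrable (f : E) (A : set X) : measurable A ->
  mu.-integrable A (EFin \o incl f).
Proof.
move=> mA; apply: (@integrableS _ _ _ _ setT) => //.
apply/integrableP; split; first exact/measurable_EFinP/measurable_funP.
exact: le_lt_trans (bfs_alpha bfsE measurableT mu_fin f) (ltry _).
Qed.

Lemma bfs_Rintegral_norm_le (f : E) (A : set X) : measurable A ->
  \int[mu]_(x in A) `|incl f x| <= alpha A * `|f|.
Proof.
move=> mA; have muA : (mu A < +oo)%E.
  by apply: le_lt_trans mu_fin; apply: le_measure; rewrite ?inE.
have := bfs_alpha bfsE mA muA f; rewrite -lee_fin /Rintegral => le_f.
rewrite fineK// ge0_fin_numE ?integral_ge0//.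
exact: le_lt_trans le_f (ltry _).
Qed.

End banach_function_space.

(** * Closed balls and integrals over symmetric differences *)

Lemma measurable_cball (d : measure_display) (R : realType)
    (X : borelMetricType d R) (x : X) (s : R) : measurable (cball x s).
Proof.
rewrite -[cball x s]setCK; apply: measurableC; apply: borel_measurable.
rewrite openE => y /= /negP; rewrite -ltNge => sxy.
rewrite /interior; apply/nbhs_ballP; exists (mdist x y - s).
  by rewrite /= subr_gt0.
move=> z; rewrite ballEmdist /= => yz; apply/negP; rewrite -ltNge.
have := metric_triangle x z y; rewrite (metric_sym z y); lra.
Qed.

Section Rintegral_setY.
Context (d : measure_display) (T : measurableType d) (R : realType).
Variable mu : {measure set T -> \bar R}.

Lemma Rintegral_setID (A B : set T) (f : T -> R) :
  measurable A -> measurable B ->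
  mu.-integrable A (EFin \o f) ->
  \int[mu]_(x in A) f x =
  \int[mu]_(x in A `&` B) f x + \int[mu]_(x in A `\` B) f x.
Proof.
move=> mA mB fA; rewrite -Rintegral_setU ?setUIDK//.
- exact: measurableI.
- exact: measurableD.
- by apply/disj_setPS => x [[_ Bx] [_ /(_ Bx)]].
Qed.

(** The contributions of the intersection cancel; what remains lives on the two differences, which
    are disjoint with union the symmetric difference. *)
Lemma Rintegral_setY_le (A B : set T) (f : T -> R) :
  measurable A -> measurable B -> mu.-integrable setT (EFin \o f) ->
  `|\int[mu]_(x in A) f x - \int[mu]_(x in B) f x|
    <= \int[mu]_(x in A `+` B) `|f x|.
Proof.
move=> mA mB fT.
have fS D : measurable D -> mu.-integrable D (EFin \o f).
  by move=> mD; apply: (@integrableS _ _ _ _ setT).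
have mAB : measurable (A `\` B) by exact: measurableD.
have mBA : measurable (B `\` A) by exact: measurableD.
rewrite (@Rintegral_setID A B)//; last exact: fS.
rewrite (@Rintegral_setID B A)//; last exact: fS.
rewrite [B `&` A]setIC opprD addrACA subrr add0r setY_def Rintegral_setU//.
- rewrite (le_trans (ler_normB _ _))// lerD// le_normr_Rintegral//; exact: fS.
- have -> : EFin \o (fun x => `|f x|) = abse \o (EFin \o f) by [].
  by apply: integrable_abse; apply: fS; exact: measurableU.
- by apply/disj_setPS => x [[_ nBx] [Bx _]].
Qed.

End Rintegral_setY.

(** * Uniform bounds and equicontinuity of the averages *)

Section averaging.
Context (d : measure_display) (R : realType) (X : borelMetricType d R).
Variable mu : {measure set X -> \bar R}.
Variables (E : completeNormedModType R) (incl : E -> {mfun_ mu, X >-> R}).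
Variable alpha : set X -> R.
Hypothesis bfsE : is_banach_function_space incl alpha.
Hypothesis mu_fin : (mu setT < +oo)%E.
Variables (r c : R).
Hypothesis c_gt0 : 0 < c.
Hypothesis c_le : forall x, c <= fine (mu (cball x r)).

Let mball_gt0 x : 0 < fine (mu (cball x r)).
Proof. exact: lt_le_trans c_gt0 (c_le x). Qed.

Let invm_le x : `|(fine (mu (cball x r)))^-1| <= c^-1.
Proof.
by rewrite ger0_norm ?lef_pV2 ?posrE// invr_ge0; exact: ltW (mball_gt0 x).
Qed.

(** Enlarging the ball to the whole space gives one constant for all centers. *)
Let Rint_le (f : E) x :
  `|\int[mu]_(y in cball x r) incl f y| <= alpha setT * `|f|.
Proof.
have mB := measurable_cball x r.
have fT := bfs_integrable bfsE mu_fin f measurableT.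
apply: le_trans (bfs_Rintegral_norm_le bfsE mu_fin f measurableT).
(* Comparison with the empty set bounds the absolute value of the integral by the integral of the
   absolute value. *)
have := Rintegral_setY_le mB measurable0 fT.
rewrite Rintegral_set0 subr0 setY0 => /le_trans; apply.
rewrite (@Rintegral_setID _ _ _ _ setT (cball x r))//.
  by rewrite setTI lerDl Rintegral_ge0.
exact: integrable_abse fT.
Qed.

Lemma average_le (f : E) x :
  `|average mu r (incl f) x| <= alpha setT * `|f| / c.
Proof.
by rewrite /average normrM mulrC ler_pM.
Qed.

Lemma average_dist_le (f : E) x y :
  `|average mu r (incl f) x - average mu r (incl f) y| <=
  (`|fine (mu (cball x r)) - fine (mu (cball y r))| / c ^+ 2 * alpha setT +
   alpha (cball x r `+` cball y r) / c) * `|f|.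
Proof.
have mx := measurable_cball x r; have my := measurable_cball y r.
have fT := bfs_integrable bfsE mu_fin f measurableT.
have mxy : measurable (cball x r `+` cball y r).
  by rewrite setY_def; apply: measurableU; exact: measurableD.
have := le_trans (Rintegral_setY_le mx my fT)
  (bfs_Rintegral_norm_le bfsE mu_fin f mxy).
have := Rint_le f y; rewrite /average.
have := invm_le x; have := invm_le y; have := mball_gt0 x; have := mball_gt0 y.
move: (fine (mu (cball x r))) (fine (mu (cball y r))) => a b.
move: (\int[mu]_(z in cball x r) _) (\int[mu]_(z in cball y r) _) => u v.
move=> b0 a0 cb ca vE uvE.
(* The first term carries the change of ball measure and is bounded by [Rint_le]; the second carries
   the change of ball and is bounded by (B5) on the symmetric difference. *)
have -> : a^-1 * u - b^-1 * v = (b - a) * (a^-1 * b^-1) * v + a^-1 * (u - v).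
  by field; rewrite !gt_eqF.
rewrite (le_trans (ler_normD _ _))// [leRHS]mulrDl lerD// normrM.
  rewrite -mulrA ler_pM// normrM distrC ler_wpM2l//.
  by rewrite normrM expr2 invfM ler_pM.
by rewrite mulrAC mulrC ler_pM.
Qed.

(** The limits are punctured: at [y = x] the symmetric difference is empty, yet (B5) makes
    [alpha set0] positive. *)
Hypothesis mu_cvg : forall x, mu (cball y r) @[y --> x^'] --> mu (cball x r).
Hypothesis alpha_cvg : forall x,
  alpha (cball x r `+` cball y r) @[y --> x^'] --> (0 : R).

(** The bound of [average_dist_le] depends on [f] only through its norm, so a single modulus [k]
    serves all [f] of norm at most [M]. *)
Lemma average_equicontinuous (M e : R) x : 0 < e ->
  \forall y \near x, forall f : E, `|f| <= M ->
    `|average mu r (incl f) x - average mu r (incl f) y| <= e.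
Proof.
move=> e0; pose m (y : X) := fine (mu (cball y r)).
pose k (y : X) := (`|m x - m y| / c ^+ 2 * alpha setT +
   alpha (cball x r `+` cball y r) / c) * `|M|.
have k0 : k y @[y --> x^'] --> (0 : R).
  have -> : 0 = (`|m x - m x| / c ^+ 2 * alpha setT + 0 / c) * `|M|.
    by rewrite subrr normr0 !mul0r add0r mul0r.
  have mxx : m y @[y --> x^'] --> m x.
    apply: fine_cvg; rewrite /m fineK; first exact: mu_cvg.
    rewrite ge0_fin_numE// (le_lt_trans _ mu_fin)//.
    by apply: le_measure; rewrite ?inE//; exact: measurable_cball.
  apply: cvgMl; apply: cvgD; last by apply: cvgMl; exact: alpha_cvg.
  do 2 apply: cvgMl; apply: cvg_norm; apply: cvgB => //; exact: cvg_cst.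
have /cvgrPdist_le/(_ _ e0) := k0; rewrite near_withinE.
apply: filterS => y ky f fM.
have [->|/ky] := eqVneq y x; first by rewrite subrr normr0 ltW.
rewrite sub0r normrN => /(le_trans (ler_norm _)); apply: le_trans.
apply: le_trans (average_dist_le f x y) _.
have alpha_ge0 A : measurable A -> 0 <= alpha A.
  move=> mA; rewrite ltW// (bfs_alpha_gt0 bfsE)//.
  by apply: le_lt_trans mu_fin; apply: le_measure; rewrite ?inE.
rewrite ler_wpM2l ?(le_trans fM) ?ler_norm// addr_ge0//.
  by rewrite !mulr_ge0 ?invr_ge0 ?exprn_ge0 ?alpha_ge0// ltW.
rewrite divr_ge0 ?alpha_ge0 ?(ltW c_gt0)// setY_def.
by apply: measurableU; apply: measurableD; exact: measurable_cball.
Qed.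

End averaging.

(** * Covering almost all of the space by a sequence of small balls *)

Lemma vitali_sequence (d : measure_display) (R : realType)
    (X : borelMetricType d R) (mu : {measure set X -> \bar R})
    (delta : X -> R) :
  vitali_covering_property mu -> (forall x, 0 < delta x) ->
  (0 < mu setT)%E ->
  exists (b : nat -> set X) (x_ : nat -> X),
    [/\ forall n, measurable (b n),
        forall n, b n `<=` cball (x_ n) (delta (x_ n)) &
        mu.-negligible (~` \bigcup_n b n)].
Proof.
move=> vit delta_gt0 mu_gt0.
(* The cap 1 gives the uniform bound on radii that the covering property demands; the cap [delta x]
   keeps each ball small enough for its center. *)
pose F := [set b | exists x s,
  [/\ 0 < s, s <= Num.min 1 (delta x) & b = cball x s]].
have Fball x s : 0 < s -> s <= Num.min 1 (delta x) -> F (cball x s).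
  by move=> s0 s1; exists x, s.
have min_gt0 x : 0 < Num.min 1 (delta x) by rewrite lt_min ltr01 delta_gt0.
have [|x _|F' [F'F cF' _]] := vit setT F.
- exists 1 => b [x [s [s0 s1 ->]]]; exists x, s; split => //.
  by rewrite (le_trans s1)// ge_min lexx.
- split; first by exists (Num.min 1 (delta x)); split => //; exact: Fball.
  apply/eqP; rewrite eq_le; apply/andP; split.
    apply/ler_addgt0Pl => e e0; rewrite addr0.
    apply: (@le_trans _ _ (Num.min e (Num.min 1 (delta x)))); last first.
      by rewrite ge_min lexx.
    apply: ge_inf; first by exists 0 => s [/ltW].
    have em0 : 0 < Num.min e (Num.min 1 (delta x)) by rewrite lt_min e0 min_gt0.
    by split => //; apply: Fball => //; rewrite ge_min lexx orbT.
  apply: lb_le_inf; last by move=> s [/ltW].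
  by exists (Num.min 1 (delta x)); split => //; exact: Fball.
rewrite setTD => F'null.
have mF' b : F' b -> measurable b.
  by move=> /F'F[x [s [_ _ ->]]]; exact: measurable_cball.
(* An empty subfamily would make the whole space null, so [F'] is the range of a sequence, possibly
   with repetitions. *)
move: F'null; have [F'0|[b]] := pfcard_geP cF'.
  rewrite F'0 bigcup_set0 setC0 measurable_mu_extE// => mu0.
  by rewrite mu0 ltxx in mu_gt0.
have bF' n : F' (b n) by exact: funS.
have mb n : measurable (b n) by exact: mF'.
have /choice[x_ x_P] n : exists x, b n `<=` cball x (delta x).
  have [x [s [_ + ->]]] := F'F _ (bF' n).
  rewrite le_min => /andP[_ sx]; exists x => y /= ys.
  exact: le_trans ys sx.
have -> : \bigcup_(B in F') B = \bigcup_n b n.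
  apply/seteqP; split=> [y [B F'B By]|y [n _ bny]]; last by exists (b n).
  by have [n _ nB] := 'surj_b F'B; exists n => //; rewrite nB.
have mU : measurable (\bigcup_n b n) by exact: bigcupT_measurable.
rewrite measurable_mu_extE; last exact: measurableC.
move=> null; exists b, x_; split => //.
by exists (~` \bigcup_n b n); split => //; exact: measurableC.
Qed.

(** * Positive lower bounds and rounding of bounded sequences *)

Lemma ereal_inf_gt0P (R : realType) (S : set (\bar R)) :
  (0 < ereal_inf S)%E -> exists2 c : R, 0 < c & forall y, S y -> (c%:E <= y)%E.
Proof.
have lbS y : S y -> (ereal_inf S <= y)%E by move=> /ereal_inf_lbound.
case: (ereal_inf S) lbS => [c lbS c0| lbS _|//].
  by exists c.
(* When the infimum is [+oo], any positive real is a lower bound. *)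
by exists 1 => // y /lbS; apply: le_trans; rewrite leey.
Qed.

(** Each of the first [n] coordinates, shifted by [C] to become nonnegative, is rounded down to a
    multiple of [e]. Values in [[-C, C]] fall into [K.+1] cells, so [inord] never falls back on its
    default there. *)
Lemma small_fibers_box (R : realType) (C e : R) (n : nat) : 0 < e ->
  exists (I : finType) (k : (nat -> R) -> I), forall u v : nat -> R,
    (forall i, `|u i| <= C) -> (forall i, `|v i| <= C) -> k u = k v ->
    forall i, (i < n)%N -> `|u i - v i| <= e.
Proof.
move=> e0; pose K := Num.truncn ((C + C) / e).
pose t (x : R) := Num.truncn ((x + C) / e).
have tK x : `|x| <= C -> (t x < K.+1)%N.
  rewrite ler_norml => /andP[_ xC].
  by rewrite ltnS le_truncn// ler_pM2r ?invr_gt0// lerD2r.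
exists {ffun 'I_n -> 'I_K.+1}, (fun u => [ffun i : 'I_n => inord (t (u i))]).
move=> u v uC vC /ffunP uv i lt_in.
have := uv (Ordinal lt_in); rewrite !ffunE /= => /(congr1 val) /=.
rewrite !inordK ?tK// => tuv.
have tP x : `|x| <= C -> (t x)%:R * e <= x + C < (t x)%:R * e + e.
  rewrite ler_norml => /andP[Cx _]; rewrite -ler_pdivlMr//.
  rewrite -[X in _ < _ + X]mul1r -mulrDl -ltr_pdivrMr// natr1.
  by apply: truncn_itv; rewrite divr_ge0 ?(ltW e0)// -lerBlDr sub0r.
have /andP[u1 u2] := tP _ (uC i); have /andP[v1 v2] := tP _ (vC i).
rewrite -tuv in v1 v2; rewrite ler_norml; apply/andP; split; lra.
Qed.

(** * Total boundedness of the averages of a bounded set *)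

Theorem theorem1p1 (d : measure_display) (R : realType)
    (X : borelMetricType d R) (mu : {measure set X -> \bar R})
    (mu_cball : forall (x : X) (s : R), 0 < s ->
       (0 < mu (cball x s) < +oo)%E)
    (r : R) (r_gt0 : 0 < r)
    (E : completeNormedModType R) (incl : E -> {mfun_ mu, X >-> R})
    (alpha : set X -> R)
    (bfsE : is_banach_function_space incl alpha)
    (ArE : average_stable incl r)
    (vitali : vitali_covering_property mu)
    (inf_gt0 : (0 < ereal_inf [set mu (cball x r) | x in [set: X]])%E)
    (ball_cvg : forall x : X,
       mu (cball y r) @[y --> x^'] --> mu (cball x r) /\
       alpha (cball x r `+` cball y r) @[y --> x^'] --> (0 : R))
    (abs_cont : absolutely_continuous_wrt1 incl) :
  (mu [set: X] < +oo)%E -> compact_operator (average_op ArE).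
Proof.
move=> mu_fin B /pinfty_ex_gt0[M M0 BM].
have muT_gt0 : (0 < mu setT)%E.
  have /andP[+ _] := mu_cball point r r_gt0.
  move=> /lt_le_trans; apply; apply: le_measure; rewrite ?inE//.
  exact: measurable_cball.
have [c c0 c_le] : exists2 c : R, 0 < c & forall x, c <= fine (mu (cball x r)).
  have [c c0 c_le] := ereal_inf_gt0P inf_gt0; exists c => // x.
  rewrite -lee_fin fineK; first by apply: c_le; exists x.
  by rewrite ge0_fin_numE//; have /andP[] := mu_cball x r r_gt0.
have mu_cvg x := (ball_cvg x).1.
have alpha_cvg x := (ball_cvg x).2.
(* The estimates are made at every point on [avg f], with which the representative of
   [average_op ArE f] agrees only a.e. *)
pose avg f := average mu r (incl f).
have avgE f : incl (average_op ArE f) = avg f %[ae mu].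
  by rewrite /average_op; case: cid.
pose C := alpha setT * M / c.
have avg_le f x : B f -> `|avg f x| <= C.
  move=> Bf; apply: le_trans (average_le bfsE mu_fin c0 c_le f x) _.
  rewrite ler_pM2r ?invr_gt0// ler_pM2l ?(bfs_alpha_gt0 bfsE)//.
  exact: BM.
have C0 : 0 <= C.
  by rewrite divr_ge0 ?mulr_ge0 ?(ltW c0) ?(ltW M0) ?ltW ?(bfs_alpha_gt0 bfsE).
have [one oneE] := bfs_indic bfsE measurableT mu_fin.
apply: precompact_finite_coloring => e e0.
(* Makes [3 * eps] times the norm of [one] at most [e / 2]. *)
pose eps := e / (6 * (`|one| + 1)).
have eps0 : 0 < eps by rewrite divr_gt0// mulr_gt0// ltr_wpDl.
have /choice[delta deltaP] x : exists delta : R, 0 < delta /\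
    forall f y, B f -> cball x delta y -> `|avg f x - avg f y| <= eps.
  have := average_equicontinuous bfsE mu_fin c0 c_le mu_cvg alpha_cvg M x eps0.
  (* Halving the radius fits a closed ball inside the open one. *)
  move=> /nbhs_ballP[s /= s0 sP]; exists (s / 2); split.
    by rewrite divr_gt0.
  move=> f y Bf ys; apply: sP; last exact: BM.
  by rewrite ballEmdist /= (le_lt_trans ys)// ltr_pdivrMr// ltr_pMr// ltr1n.
have [b [x_ [mb bx null]]] :=
  vitali_sequence vitali (fun x => (deltaP x).1) muT_gt0.
pose A n := ~` \bigcup_(i < n) b i.
have mA n : measurable (A n) by apply/measurableC/bigcup_measurable.
have muA n : (mu (A n) < +oo)%E.
  by apply: le_lt_trans mu_fin; apply: le_measure; rewrite ?inE.
have /choice[chi chiE] n := bfs_indic bfsE (mA n) (muA n).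
have chi0 : `|chi n| @[n --> \oo] --> (0 : R).
  (* A point of [b n] lies outside [A m] for all [m > n], so off a null set the indicators are
     eventually 0. *)
  apply: (abs_cont A) => //; apply: negligibleS null => x /= xA [n _ bnx].
  apply: xA; apply: cvg_near_cst; exists n.+1 => // m /= nm.
  apply/eqP; rewrite indicE; case: (boolP (_ \in _)) => //; rewrite inE.
  by case; exists n.
(* Makes [2 * C] times the norm of [chi n] less than [e / 2]; [C + 1] is positive since [C] is
   nonnegative. *)
have eta0 : 0 < e / (4 * (C + 1)) by rewrite divr_gt0// mulr_gt0// ltr_wpDl.
have /cvgrPdist_lt/(_ _ eta0)[n _ /(_ n (leqnn n))] := chi0.
rewrite /= sub0r normrN normr_id => chin.
have [I [k kP]] := small_fibers_box C n eps0.
exists I, (fun f => k (fun i => avg f (x_ i))) => f g Bf Bg kfg.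
have fg := kP _ _ (fun i => avg_le f _ Bf) (fun i => avg_le g _ Bg) kfg.
(* On a ball [b i] with [i < n], the oscillations of [avg f] and [avg g] and their gap at [x_ i]
   cost [eps] each; on [A n] both averages are bounded by [C]. *)
apply: (@le_lt_trans _ _ `|(3 * eps) *: one + (2 * C) *: chi n|).
  apply: (bfs_dominated bfsE).
  near=> x.
  rewrite (_ : incl (_ - _) x = avg f x - avg g x); last first.
    transitivity (incl (average_op ArE f) x - incl (average_op ArE g) x).
      by near: x; apply: filterS (bfs_sub bfsE _ _) => y; apply.
    congr (_ - _); near: x; first by apply: filterS (avgE f) => y; apply.
    by apply: filterS (avgE g) => y; apply.
  rewrite (_ : incl (_ + _) x = 3 * eps * \1_setT x + 2 * C * \1_(A n) x);
    last first.
    transitivity (3 * eps * incl one x + 2 * C * incl (chi n) x).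
      by near: x; apply: filterS (bfs_lincomb2 bfsE _ _ _ _) => y; apply.
    congr (_ * _ + _ * _); near: x; first by apply: filterS oneE => y; apply.
    by apply: filterS (chiE n) => y; apply.
  rewrite !indicE in_setT mulr1; apply: le_trans (ler_norm _).
  case: (boolP (x \in A n)) => xA.
    rewrite (le_trans (ler_normB _ _))//.
    rewrite mulr1; have := avg_le f x Bf; have := avg_le g x Bg.
    by move: eps0; clearbody eps C; lra.
  move: xA; rewrite notin_setE /A /= => /contrapT[i /= lt_in bix].
  have xi := bx _ _ bix.
  have := (deltaP (x_ i)).2 f x Bf xi; have := (deltaP (x_ i)).2 g x Bg xi.
  have := fg i lt_in; rewrite mulr0 addr0 !ler_norml; lra.
have eps3_ge0 : 0 <= 3 * eps by apply: mulr_ge0 => //; exact: ltW.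
have C2_ge0 : 0 <= 2 * C by exact: mulr_ge0.
rewrite (le_lt_trans (ler_normD _ _))// (normrZ _ one) (normrZ _ (chi n)).
rewrite (ger0_norm eps3_ge0) (ger0_norm C2_ge0).
have eps_one : 3 * eps * `|one| <= e / 2.
  rewrite /eps; have := normr_ge0 one; move: (`|one|) => t t0.
  have -> : 3 * (e / (6 * (t + 1))) * t = e / 2 * (t / (t + 1)).
    by field; rewrite gt_eqF// ltr_wpDl.
  by rewrite ler_piMr ?divr_ge0 ?(ltW e0)// ler_pdivrMr ?ltr_wpDl// mul1r lerDl.
have C_chi : 2 * C * `|chi n| < e / 2.
  have -> : e / 2 = 2 * (C + 1) * (e / (4 * (C + 1))).
    by field; rewrite gt_eqF// ltr_wpDl.
  apply: (@le_lt_trans _ _ (2 * (C + 1) * `|chi n|)).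
    by rewrite ler_wpM2r// ler_pM2l// lerDl.
  by rewrite ltr_pM2l// mulr_gt0// ltr_wpDl.
by rewrite [ltRHS]splitr ler_ltD.
Unshelve. all: by end_near. Qed.
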